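(* Let $(X,+,d)$ be a metric Abelian group, let $n_0\in\mathbb{N}$ be such that $\mu_d(n_0)>1$ and let $D\subseteq X$ be a closed bounded $n_0$-convex set. Let $f:D\to\mathbb{R}$, $n\in\mathbb{N}$ and $(T_1,t_1),\dots,(T_n,t_n)\in\mathcal{R}_f^d$ with $t_1,\dots,t_n\in\,]0,1[$. Assume that the endomorphisms $T_1,\dots,T_n$ are pairwise commuting and, for $k\in\{0,\dots,n\}$, define $$S_k:=T_1\circ\dots\circ T_k\circ(I-T_{k+1})\circ\dots\circ(I-T_n)\quad\text{and}\quad s_k:=t_1\cdots t_k\cdot(1-t_{k+1})\cdots(1-t_n).$$ Assume that $S:=S_0+\dots+S_n$ is a bijection with $S^{-1}\in\mathcal{E}^d(X)$ and denote $s:=s_0+\dots+s_n$. Then, for all $k\in\{1,\dots,n\}$, we have $$\big(S^{-1}\circ(S_k+\cdots+S_n),\,s^{-1}(s_k+\dots+s_n)\big)\in\mathcal{R}_f^d.$$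
   Context: A metric Abelian group $(X,+,d)$ is an Abelian group with a translation invariant metric $d$; $\|x\|_d:=d(x,0)$. $\mathcal{E}(X)$ is the ring of all endomorphisms of $X$ (pointwise addition, composition), $I$ is the identity. $T\in\mathcal{E}(X)$ is $d$-bounded if there is $c\geq0$ with $\|T(x)\|_d\leq c\|x\|_d$ for all $x\in X$; $\mathcal{E}^d(X)$ is the subring of $d$-bounded endomorphisms. For $n\in\mathbb{N}$, $n\cdot x$ denotes $x+\dots+x$ ($n$ terms), and $\mu_d(n)$ is the largest number such that $\mu_d(n)\|x\|_d\leq\|n\cdot x\|_d$ for all $x\in X$. A set $A\subseteq X$ is $n$-convex if $\{n\cdot x\mid x\in A\}=\{x_1+\dots+x_n\mid x_1,\dots,x_n\in A\}$. For $T\in\mathcal{E}(X)$, a set $D\subseteq X$ is $T$-convex if $T(x)+(I-T)(y)\in D$ for all $x,y\in D$. For $(T,t)\in\mathcal{E}(X)\times[0,1]$, a function $f:D\to[-\infty,+\infty[$ is $(T,t)$-convex if $D$ is $T$-convex and $f(T(x)+(I-T)(y))\leq tf(x)+(1-t)f(y)$ for all $x,y\in D$ (convention $0\cdot(-\infty)=0$). $\mathcal{R}_f:=\{(T,t)\in\mathcal{E}(X)\times[0,1]\mid f\text{ is }(T,t)\text{-convex}\}$, and $\mathcal{R}_f^d$ is the set of those $(T,t)\in\mathcal{R}_f$ with $T\in\mathcal{E}^d(X)$. *)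

(* Defs.v *)
From HB Require Import structures.
From mathcomp Require Import all_boot all_order all_algebra.
From mathcomp Require Import all_classical all_reals.
From mathcomp Require Import topology_structure metric_structure ereal.

Set Implicit Arguments.
Unset Strict Implicit.
Unset Printing Implicit Defensive.

Import Order.TTheory GRing.Theory Num.Theory.

Local Open Scope classical_set_scope.
Local Open Scope ring_scope.

HB.mixin Record Metric_isTranslationInvariant (R : numDomainType) X
    & Metric R X & GRing.Zmodule X := {
  mdist_addr : forall x y z : X, mdist (x + z) (y + z) = mdist x y
}.

(* Metric Abelian groups.  The library's pseudoMetricNormedZmodType does not fit:
   its norm satisfies `|x *+ n| = `|x| *+ n, which fails in general here. *)
#[short(type="metricZmodType")]
HB.structure Definition MetricZmodule (R : numDomainType) :=
  { X of Metric R X & GRing.Zmodule X & Metric_isTranslationInvariant R X }.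

Section Definitions.
Context {R : realType} {X : metricZmodType R}.
Implicit Types (x y : X) (A D : set X) (T : X -> X) (f : X -> \bar R) (n : nat).

Definition dnorm x : R := mdist x 0.

(* Endomorphisms are additive maps; X -> X carries the pointwise additive
   structure, so that the endomorphism I - T is [idfun - T]. *)
Definition Endo : set (X -> X) := [set T | zmod_morphism T].

Definition dbounded T : Prop :=
  exists2 c : R, 0 <= c & forall x, dnorm (T x) <= c * dnorm x.

Definition Endod : set (X -> X) := Endo `&` dbounded.

(* The supremum is attained as soon as X is not trivial. If X = {0}, there is no
   largest number, and the value is +oo. *)
Definition mu n : \bar R :=
  ereal_sup [set c%:E | c in
    [set c : R | forall x, c * dnorm x <= dnorm (x *+ n)]].

Definition metric_bounded A : Prop :=
  exists r : R, forall x y, A x -> A y -> mdist x y <= r.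

Definition nconvex n A : Prop :=
  [set x *+ n | x in A] =
  [set \sum_(i < n) x i | x in [set x : 'I_n -> X | forall i, A (x i)]].

Definition Tconvex T D : Prop :=
  forall x y, D x -> D y -> D (T x + (idfun - T) y).

(* A function D -> [-oo, +oo[ is represented by a total function to \bar R, of which
   only the values on D matter. In \bar R, 0 * -oo = 0. *)
Definition Tt_convex D f T (t : R) : Prop :=
  Tconvex T D /\
  forall x y, D x -> D y ->
    (f (T x + (idfun - T) y)%R <= t%:E * f x + (1 - t)%:E * f y)%E.

Definition Rf D f : set ((X -> X) * R) :=
  [set p | [/\ Endo p.1, 0 <= p.2 <= 1 & Tt_convex D f p.1 p.2]].

Definition Rfd D f : set ((X -> X) * R) :=
  [set p | Rf D f p /\ Endod p.1].

(* Families are indexed from 0: T i and t i stand for T_{i+1} and t_{i+1}. *)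
Definition Sk n (T : 'I_n -> X -> X) (k : nat) : X -> X :=
  (\big[comp/idfun]_(i < n | (i < k)%N) T i) \o
  (\big[comp/idfun]_(i < n | (k <= i)%N) (idfun - T i)).

Definition sk n (t : 'I_n -> R) (k : nat) : R :=
  (\prod_(i < n | (i < k)%N) t i) * \prod_(i < n | (k <= i)%N) (1 - t i).

End Definitions.

Arguments mu {R} X n.

(* Main.v *)
Require Import Defs.
From HB Require Import structures.
From mathcomp Require Import all_boot all_order all_algebra.
From mathcomp Require Import all_classical all_reals.
From mathcomp Require Import topology_structure metric_structure ereal.
From mathcomp Require Import pseudometric_structure.
From mathcomp Require Import ring lra.

(** Index the family from 0, so that [T i] is T_(i+1), and fix x, y in D. The
    chain u_m = y + S^-1 (S_m + ... + S_n) (x - y), for 0 <= m <= n + 1, joins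
    u_0 = x to u_(n+1) = y, and u_k is the point at which the theorem bounds f.
    Since T_i S_i = (I - T_i) S_(i+1), each inner point of the chain is a
    T_i-convex combination of its two neighbours:
      u_(i+1) = T_i u_i + (I - T_i) u_(i+2)
    ([interpolation_harmonic]).

    Once the chain is known to lie in D, the values f u_m satisfy
    f u_(i+1) <= t_i f u_i + (1 - t_i) f u_(i+2). The numbers
    f y + s^-1 (s_m + ... + s_n) (f x - f y) satisfy the same relation with
    equality and the same end values, so that [discrete_max_principle] gives the
    inequality.

    The hard part is that the chain lies in D ([harmonic_mem]): the u_m are a
    fixed point of the relaxation w |-> (T_i w_i + (I - T_i) w_(i+2)), which
    maps D-valued sequences to D-valued ones, but whose iterates z^0, z^1, ...
    have no reason to converge. Averages of N of them do come close to the chain.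
    Let E_m(N) = sum_(q < N) (z^q_m - u_m) and d_m = E_m - E_(m+1). Telescoping
    gives
      (I - T_i) d_(i+1) - T_i d_i = z^0_(i+1) - z^N_(i+1),
    which is bounded in N because D is bounded. Hence S_m d_j and S_j d_m differ
    by a bounded sequence, and the sum of these differences over j is, up to
    sign, S d_m, since the d_j sum up to 0. As S^-1 is bounded, so are d_m and
    E_m ([almost_harmonic_bounded]). For N = n0 ^ p, the n0-convexity of D yields
    w in D with sum_(q < N) z^q_m = N w; then N (w - u_m) = E_m(N) is bounded
    independently of p, whereas its norm is at least c ^ p times that of w - u_m
    for some c > 1. So u_m is a limit of points of the closed set D
    ([mean_limit_mem]). *)

Import Order.TTheory GRing.Theory Num.Theory.

Local Open Scope classical_set_scope.
Local Open Scope ring_scope.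

(** * Translation invariant norms and bounded sequences *)

Section Norm.
Context {R : realType} {X : metricZmodType R}.
Implicit Types (x y : X) (g h : nat -> X).

Lemma mdist_dnorm x y : mdist x y = dnorm (x - y).
Proof. by rewrite /dnorm -(mdist_addr x y (- y)) subrr. Qed.

Lemma dnorm_ge0 x : 0 <= dnorm x.
Proof. exact: mdist_ge0. Qed.

Lemma dnormN x : dnorm (- x) = dnorm x.
Proof. by rewrite -(sub0r x) -mdist_dnorm metric_sym. Qed.

Lemma dnormD x y : dnorm (x + y) <= dnorm x + dnorm y.
Proof.
rewrite -{1}(opprK y) -mdist_dnorm (le_trans (metric_triangle _ 0 _))//.
by rewrite (metric_sym 0) mdist_dnorm subr0 mdist_dnorm subr0 dnormN.
Qed.

Definition bounded_seq g := exists C : R, forall N, dnorm (g N) <= C.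

Lemma eq_bounded_seq {g} h : (forall N, g N = h N) -> bounded_seq g ->
  bounded_seq h.
Proof. by move=> e [C hC]; exists C => N; rewrite -e. Qed.

Lemma bounded_seqD {g h} : bounded_seq g -> bounded_seq h ->
  bounded_seq (fun N => g N + h N).
Proof.
move=> [C hC] [C' hC']; exists (C + C') => N.
by rewrite (le_trans (dnormD _ _))// lerD.
Qed.

Lemma bounded_seqN {g} : bounded_seq g -> bounded_seq (fun N => - g N).
Proof. by move=> [C hC]; exists C => N; rewrite dnormN. Qed.

Lemma bounded_seqB {g h} : bounded_seq g -> bounded_seq h ->
  bounded_seq (fun N => g N - h N).
Proof. by move=> bg bh; exact: bounded_seqD bg (bounded_seqN bh). Qed.

Lemma bounded_seq_cst x : bounded_seq (fun=> x).
Proof. by exists (dnorm x). Qed.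

Lemma bounded_seq_sum (s : seq nat) (F : nat -> nat -> X) :
  (forall i, i \in s -> bounded_seq (F i)) ->
  bounded_seq (fun N => \sum_(i <- s) F i N).
Proof.
elim: s => [_|i s IH hF].
  apply: eq_bounded_seq (bounded_seq_cst 0) => N; by rewrite big_nil.
have bi := hF i (mem_head _ _).
have bs := IH (fun j js => hF j (@mem_behead _ (i :: s) j js)).
by apply: eq_bounded_seq (bounded_seqD bi bs) => N; rewrite big_cons.
Qed.

Lemma bounded_seq_dbounded {T : X -> X} {g} : dbounded T -> bounded_seq g ->
  bounded_seq (T \o g).
Proof.
move=> [c c0 hc] [C hC]; exists (c * C) => N.
by rewrite (le_trans (hc _))// ler_wpM2l.
Qed.

End Norm.

(** * Bounded endomorphisms *)

Section Endomorphisms.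
Context {R : realType} {X : metricZmodType R}.
Implicit Types (x y : X) (T U : X -> X).

Lemma EndoB {T} : Endo T -> forall x y, T (x - y) = T x - T y.
Proof. by move=> eT x y; exact: eT. Qed.

Lemma Endo0 {T} : Endo T -> T 0 = 0.
Proof. by move=> eT; have := EndoB eT 0 0; rewrite !subrr. Qed.

Lemma EndoN {T} : Endo T -> forall x, T (- x) = - T x.
Proof. by move=> eT x; rewrite -sub0r (EndoB eT) (Endo0 eT) sub0r. Qed.

Lemma EndoD {T} : Endo T -> forall x y, T (x + y) = T x + T y.
Proof. by move=> eT x y; rewrite -{1}(opprK y) (EndoB eT) (EndoN eT) opprK. Qed.

Lemma Endo_sum {T} : Endo T -> forall (s : seq nat) (F : nat -> X),
  T (\sum_(i <- s) F i) = \sum_(i <- s) T (F i).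
Proof. by move=> eT s F; apply: (big_morph T (EndoD eT) (Endo0 eT)). Qed.

Lemma subfE T x : (idfun - T) x = x - T x.
Proof. by []. Qed.

Lemma Endod_idfun : Endod (idfun : X -> X).
Proof. by split => //; exists 1 => // x; rewrite mul1r. Qed.

Lemma Endod_comp {T U} : Endod T -> Endod U -> Endod (T \o U).
Proof.
move=> [eT [c c0 hc]] [eU [c' c'0 hc']]; split.
  by move=> x y; rewrite /= (EndoB eU) (EndoB eT).
exists (c * c') => [|x /=]; first exact: mulr_ge0.
by rewrite (le_trans (hc _))// -mulrA ler_wpM2l.
Qed.

Lemma Endod_sub {T U} : Endod T -> Endod U -> Endod (T - U).
Proof.
move=> [eT [c c0 hc]] [eU [c' c'0 hc']]; split.
  move=> x y; rewrite !fctE (EndoB eU) (EndoB eT).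
  by rewrite !opprD !opprK addrACA.
exists (c + c') => [|x /=]; first exact: addr_ge0.
by rewrite (le_trans (dnormD _ _))// dnormN mulrDl lerD.
Qed.

Lemma Endod0 : Endod (0 : X -> X).
Proof. by rewrite -(subrr idfun); exact: Endod_sub Endod_idfun Endod_idfun. Qed.

Lemma Endod_sum (s : seq nat) (F : nat -> X -> X) :
  (forall i, Endod (F i)) -> Endod (\sum_(i <- s) F i).
Proof.
move=> hF; elim/big_ind: _ => //; first exact: Endod0.
move=> T U hT hU; rewrite -(opprK U) -(sub0r U).
exact: Endod_sub hT (Endod_sub Endod0 hU).
Qed.

Lemma Endod_prod (s : seq nat) (F : nat -> X -> X) :
  (forall i, Endod (F i)) -> Endod (\big[comp/idfun]_(i <- s) F i).
Proof.
move=> hF; elim/big_ind: _ => //; first exact: Endod_idfun.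
by move=> T U; exact: Endod_comp.
Qed.

End Endomorphisms.

(** * Iterated composition *)

Section Comp.
Context {X : Type}.
HB.instance Definition _ := Monoid.isLaw.Build (X -> X) idfun (@comp X X X)
  (fun _ _ _ => erefl) (fun _ => erefl) (fun _ => erefl).

Lemma comm_prod {g : X -> X} {F : nat -> X -> X} :
  (forall i x, g (F i x) = F i (g x)) -> forall j k x,
  g ((\big[comp/idfun]_(j <= i < k) F i) x) =
  (\big[comp/idfun]_(j <= i < k) F i) (g x).
Proof.
move=> gF j k; elim/big_ind: _ => // T U hT hU x /=.
by rewrite hT hU.
Qed.

Lemma prod_recr (F : nat -> X -> X) j k : (j <= k)%N ->
  \big[comp/idfun]_(j <= i < k.+1) F i =
  (\big[comp/idfun]_(j <= i < k) F i) \o F k.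
Proof. by move=> jk; rewrite big_nat_recr. Qed.

Lemma prod_cat (F : nat -> X -> X) j l k : (j <= l)%N -> (l <= k)%N ->
  \big[comp/idfun]_(j <= i < k) F i =
  (\big[comp/idfun]_(j <= i < l) F i) \o (\big[comp/idfun]_(l <= i < k) F i).
Proof. by move=> jl lk; rewrite (big_cat_nat jl lk). Qed.
End Comp.

(** * Almost harmonic sequences *)

Section Telescoping.
Context {R : realType} {X : metricZmodType R}.
Context (T : nat -> X -> X) (TE : forall i, Endod (T i)).
Context (Tcomm : forall i j x, T i (T j x) = T j (T i x)).
Implicit Types (i j k n : nat) (x : X).

Let B i : X -> X := idfun - T i.
Let PT j k : X -> X := \big[comp/idfun]_(j <= i < k) T i.
Let PB j k : X -> X := \big[comp/idfun]_(j <= i < k) B i.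

(** The operators S_k. Numbers, rather than ordinals, index the family, because
    the comparison of S_j with S_k splits the products at j and k. *)
Definition mixed_comp n k : X -> X := PT 0 k \o PB k n.

Let BE i : Endod (B i).
Proof. exact: Endod_sub Endod_idfun (TE i). Qed.

Let PTE j k : Endod (PT j k). Proof. exact: Endod_prod. Qed.

Let PBE j k : Endod (PB j k). Proof. exact: Endod_prod. Qed.

Lemma mixed_comp_Endod n k : Endod (mixed_comp n k).
Proof. exact: Endod_comp. Qed.

Let TB i j x : T i (B j x) = B j (T i x).
Proof. by rewrite /B !subfE (EndoB (TE i).1) Tcomm. Qed.

Let BB i j x : B i (B j x) = B j (B i x).
Proof. by rewrite {1 4}/B !subfE TB (EndoB (BE j).1). Qed.

Let PTT i j k x : PT j k (T i x) = T i (PT j k x).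
Proof. by rewrite /PT (comm_prod (Tcomm i)). Qed.

Let PBT i j k x : PB j k (T i x) = T i (PB j k x).
Proof. by rewrite /PB (comm_prod (TB i)). Qed.

Let PTB i j k x : PT j k (B i x) = B i (PT j k x).
Proof. by rewrite /PT (comm_prod (fun l y => esym (TB l i y))). Qed.

Let PBB i j k x : PB j k (B i x) = B i (PB j k x).
Proof. by rewrite /PB (comm_prod (BB i)). Qed.

Let PTPB j k l m x : PT j k (PB l m x) = PB l m (PT j k x).
Proof. exact: comm_prod (fun i => PTB i j k) _ _ _. Qed.

Let PBPB j k l m x : PB j k (PB l m x) = PB l m (PB j k x).
Proof. exact: comm_prod (fun i => PBB i j k) _ _ _. Qed.

Lemma mixed_compT n i k x : mixed_comp n k (T i x) = T i (mixed_comp n k x).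
Proof. by rewrite /mixed_comp /= PBT PTT. Qed.

(** The two sides are the same product: passing from S_i to S_(i+1) replaces
    the factor I - T_i by T_i. *)
Lemma mixed_comp_step n i x : (i < n)%N ->
  T i (mixed_comp n i x) = (idfun - T i) (mixed_comp n i.+1 x).
Proof.
move=> lin; rewrite /mixed_comp /=.
have -> : PB i n = B i \o PB i.+1 n by rewrite /PB (big_ltn lin).
have -> : PT 0 i.+1 = PT 0 i \o T i by rewrite /PT prod_recr.
by rewrite /= PTB TB -/(B i) PTT.
Qed.

Section AlmostHarmonic.
Context (n : nat) (d : nat -> nat -> X).
Hypothesis d_step : forall i, (i < n)%N ->
  bounded_seq (fun N => (idfun - T i) (d i.+1 N) - T i (d i N)).

(** Up to bounded sequences, [d_step] trades a factor T_i in front of d_i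
    for a factor I - T_i in front of d_(i+1). Repeating this from j to k turns
    d_j into d_k. *)
Let PT_PB_bounded j k : (j <= k)%N -> (k <= n)%N ->
  bounded_seq (fun N => PT j k (d j N) - PB j k (d k N)).
Proof.
elim: k => [|k IH].
  rewrite leqn0 => /eqP-> _; apply: eq_bounded_seq (bounded_seq_cst 0) => N.
  by rewrite /PT /PB !big_geq//= subrr.
rewrite leq_eqVlt => /predU1P[-> _|].
  apply: eq_bounded_seq (bounded_seq_cst 0) => N.
  by rewrite /PT /PB !big_geq//= subrr.
rewrite ltnS => jk kn; have := IH jk (ltnW kn).
move=> /(bounded_seq_dbounded (TE k).2) h1.
have := bounded_seq_dbounded (PBE j k).2 (d_step k kn) => h2.
apply: eq_bounded_seq (bounded_seqB h1 h2) => N /=.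
rewrite [PT j k.+1]prod_recr// [PB j k.+1]prod_recr//=.
rewrite (EndoB (TE k).1) (EndoB (PBE j k).1) -/(B k) -/(PT j k) -/(PB j k).
by rewrite PTT PBT opprB addrA subrK.
Qed.

(** For j <= k, S_k and S_j share the factors outside the range from j to k, and
    inside this range they are the products of the previous lemma. *)
Let mixed_comp_cross_le j k : (j <= k)%N -> (k <= n)%N ->
  bounded_seq (fun N => mixed_comp n k (d j N) - mixed_comp n j (d k N)).
Proof.
move=> jk kn.
have := bounded_seq_dbounded (Endod_comp (PTE 0 j) (PBE k n)).2
  (PT_PB_bounded j k jk kn).
apply: eq_bounded_seq => N.
have cT : PT 0 k = PT 0 j \o PT j k by rewrite /PT (prod_cat _ _ j).
have cB : PB j n = PB j k \o PB k n by rewrite /PB (prod_cat _ _ k).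
rewrite /mixed_comp cT cB /= (EndoB (PBE k n).1) (EndoB (PTE 0 j).1).
by rewrite [PT j k (PB _ _ _)]PTPB [PB j k (PB k n _)]PBPB.
Qed.

Let mixed_comp_cross j k : (j <= n)%N -> (k <= n)%N ->
  bounded_seq (fun N => mixed_comp n k (d j N) - mixed_comp n j (d k N)).
Proof.
move=> jn kn; have [jk|/ltnW kj] := leqP j k; first exact: mixed_comp_cross_le.
apply: eq_bounded_seq (bounded_seqN (mixed_comp_cross_le k j kj jn)) => N.
by rewrite opprB.
Qed.

(** Write g ~ h when g - h is bounded. As the d_j sum up to 0, summing the
    relations S_j d_k ~ S_k d_j over j gives S d_k ~ 0. So S is the only operator
    to be inverted in order to solve the tridiagonal system [d_step]. *)
Lemma almost_harmonic_bounded (Sinv : X -> X) :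
  Endod Sinv -> cancel (\sum_(0 <= j < n.+1) mixed_comp n j) Sinv ->
  (forall N, \sum_(0 <= j < n.+1) d j N = 0) ->
  forall k, (k <= n)%N -> bounded_seq (d k).
Proof.
move=> Si SK d0 k kn.
have h : bounded_seq
    (fun N => \sum_(0 <= j < n.+1)
      (mixed_comp n j (d k N) - mixed_comp n k (d j N))).
  apply: (bounded_seq_sum _ (fun j N => _)) => j.
  by rewrite mem_index_iota ltnS => /= jn; exact: mixed_comp_cross.
apply: eq_bounded_seq (bounded_seq_dbounded Si.2 h) => N /=.
have Sk_endo := (mixed_comp_Endod n k).1.
rewrite sumrB -(Endo_sum Sk_endo) d0 (Endo0 Sk_endo).
by rewrite subr0 -[RHS]SK fct_sumE.
Qed.

End AlmostHarmonic.
End Telescoping.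

(** * Averages in n-convex sets *)

Section Convexity.
Context {R : realType} {X : metricZmodType R}.
Implicit Types (D : set X) (x y u : X) (z : nat -> X).

(** Group the n0 ^ p.+1 terms into n0 blocks of n0 ^ p terms: each block is a
    multiple of one point of D, and so is the sum of these n0 points. *)
Lemma nconvex_expn n0 D (p : nat) z : nconvex n0 D -> (forall m, D (z m)) ->
  exists2 w, D w & \sum_(0 <= m < n0 ^ p) z m = w *+ n0 ^ p.
Proof.
move=> Dn; elim: p z => [|p IH] z Dz.
  by exists (z 0) => //; rewrite expn0 big_nat1.
have /choice[w hw] : forall i, exists w,
    D w /\ \sum_(0 <= m < n0 ^ p) z (i * n0 ^ p + m)%N = w *+ n0 ^ p.
  by move=> i; have [w Dw] := IH (fun m => z (i * n0 ^ p + m)%N) (fun=> Dz _);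
    exists w.
have : [set \sum_(i < n0) x i | x in [set x : 'I_n0 -> X | forall i, D (x i)]]
    (\sum_(i < n0) w i).
  by exists (fun i : 'I_n0 => w i) => // i; have [] := hw i.
rewrite -Dn => -[v Dv vE]; exists v => //.
rewrite expnS mulrnA vE -sumrMnl big_nat_mul.
rewrite big_mkord; apply: eq_bigr => i _.
rewrite -(hw i).2 -{1}[(i * _)%N]add0n big_addn mulSn addnK.
by apply: eq_bigr => m _; rewrite addnC.
Qed.

(** Lower bounds for multiplication by n0 multiply under iteration. *)
Lemma mu_expn n0 : (1 < mu X n0)%E ->
  exists2 c : R, 1 < c &
    forall p x, c ^+ p * dnorm x <= dnorm (x *+ n0 ^ p).
Proof.
move=> /ereal_sup_gt[_ [c hc <-]]; rewrite lte_fin => c1; exists c => //.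
elim=> [|p IH] x; first by rewrite expr0 mul1r expn0.
rewrite exprS -mulrA expnSr mulrnA (le_trans _ (hc _))// ler_pM2l//.
by rewrite (lt_trans ltr01).
Qed.

Lemma bernoulli_le (e : R) p : 0 <= e -> 1 + e *+ p <= (1 + e) ^+ p.
Proof.
move=> e0; elim: p => [|p IH]; first by rewrite mulr0n addr0 expr0.
have ep0 : 0 <= e *+ p by rewrite mulrn_wge0.
by rewrite exprS mulrS; nra.
Qed.

(** Let N w be the sum of the first N = n0 ^ p terms, with w in D. The norm of
    N (w - u) is at most a constant C, and at least c ^ p times that of w - u
    for some c > 1; so w is within C / c ^ p of u. *)
Lemma mean_limit_mem n0 D z u : (1 < mu X n0)%E -> closed D -> nconvex n0 D ->
  (forall m, D (z m)) ->
  bounded_seq (fun N => \sum_(0 <= m < N) (z m - u)) -> D u.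
Proof.
move=> /mu_expn[c c1 hc] Dc Dn Dz [C hC].
rewrite ((closure_id D).1 Dc) => U /nbhs_ballP[e /= e0 heU].
have e'0 : 0 < (c - 1) * e by rewrite mulr_gt0 ?subr_gt0.
(* By Bernoulli's inequality, this exponent gives c ^+ p * e > C. *)
pose p := Num.bound (C / ((c - 1) * e)).
have C0 : 0 <= C by rewrite (le_trans (dnorm_ge0 _) (hC 0)).
have hp : C < c ^+ p * e.
  have : C / ((c - 1) * e) < p%:R by rewrite archi_boundP// divr_ge0// ltW.
  rewrite ltr_pdivrMr// mulrA => /lt_le_trans; apply.
  rewrite ler_pM2r// mulr_natl.
  have := bernoulli_le (c - 1) p; rewrite subr_ge0 ltW// => /(_ isT).
  by rewrite subrKC; apply: le_trans; rewrite lerDr.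
have [w Dw wE] := nconvex_expn _ _ p _ Dn Dz.
exists w; split => //; apply: heU; rewrite ballEmdist /= metric_sym mdist_dnorm.
rewrite -(ltr_pM2l (x := c ^+ p)) ?exprn_gt0 ?(lt_trans ltr01)//.
apply: le_lt_trans hp; rewrite (le_trans (hc _ _))//.
rewrite (le_trans _ (hC (n0 ^ p)%N))// sumrB wE sumr_const_nat subn0.
by rewrite mulrnBl.
Qed.

End Convexity.

(** * Harmonic chains *)

Section Harmonic.
Context {R : realType} {X : metricZmodType R}.
Context (T : nat -> X -> X) (TE : forall i, Endod (T i)).
Context (Tcomm : forall i j x, T i (T j x) = T j (T i x)).
Context (n : nat) (Sinv : X -> X) (SinvE : Endod Sinv).
Context (SK : cancel (\sum_(0 <= j < n.+1) mixed_comp T n j) Sinv).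
Implicit Types (i j k m : nat) (x : X).

Definition harmonic (u : nat -> X) := forall i, (i < n)%N ->
  u i.+1 = T i (u i) + (idfun - T i) (u i.+2).

(** One step of Jacobi's iteration for [harmonic]: every inner entry is replaced
    by the combination of its neighbours, simultaneously. *)
Definition relax (w : nat -> X) k :=
  if k is i.+1 then
    if (i < n)%N then T i (w i) + (idfun - T i) (w i.+2) else w k
  else w k.

(** A discrete Dirichlet problem: D contains the boundary values u 0 and
    u n.+1, hence the Jacobi iterates that start from them. The u k are limits of
    averages of these iterates, as the accumulated errors are almost harmonic. *)
Lemma harmonic_mem n0 (D : set X) (u : nat -> X) :
  (1 < mu X n0)%E -> closed D -> metric_bounded D -> nconvex n0 D ->
  (forall i, (i < n)%N -> Tconvex (T i) D) ->
  harmonic u -> D (u 0) -> D (u n.+1) ->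
  forall k, (k <= n.+1)%N -> D (u k).
Proof.
move=> hn0 Dc [r hr] Dn DT hu D0 Dn1.
pose z m := iter m relax (fun k => if k is 0 then u 0 else u n.+1).
have Dz m k : D (z m k).
  elim: m k => [|m IH] [|k] //=.
  by case: ifP => // kn; exact: DT.
have z0 m : z m 0 = u 0 by elim: m.
have zn1 m : z m n.+1 = u n.+1 by elim: m => //= m IH; rewrite ltnn.
(* The errors obey the same recursion, with zero boundary values. *)
pose e m k := z m k - u k.
have eS m i : (i < n)%N ->
    e m.+1 i.+1 = T i (e m i) + (idfun - T i) (e m i.+2).
  move=> lin; rewrite /e (hu i lin) /= lin.
  rewrite (EndoB (TE i).1) (EndoB (Endod_sub Endod_idfun (TE i)).1).
  by rewrite opprD addrACA.
pose E k N := \sum_(0 <= m < N) e m k.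
have E0 N : E 0 N = 0 by rewrite /E big1// => m _; rewrite /e z0 subrr.
have En1 N : E n.+1 N = 0 by rewrite /E big1// => m _; rewrite /e zn1 subrr.
have d_bounded : forall k, (k <= n)%N ->
    bounded_seq (fun N => E k N - E k.+1 N).
  apply: (almost_harmonic_bounded T TE Tcomm n (fun k N => E k N - E k.+1 N)
    _ Sinv SinvE SK) => [i lin|N].
    exists r => N.
    have ES : \sum_(0 <= m < N) e m.+1 i.+1 =
        T i (E i N) + (idfun - T i) (E i.+2 N).
      rewrite (eq_bigr _ (fun m _ => eS m i lin)) big_split /=.
      rewrite -(Endo_sum (TE i).1).
      by rewrite -(Endo_sum (Endod_sub Endod_idfun (TE i)).1).
    have -> : (idfun - T i) (E i.+1 N - E i.+2 N) - T i (E i N - E i.+1 N) =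
        z 0 i.+1 - z N i.+1.
      rewrite (EndoB (TE i).1) (EndoB (Endod_sub Endod_idfun (TE i)).1).
      rewrite [(idfun - T i) (E i.+1 N)]subfE.
      transitivity (E i.+1 N - \sum_(0 <= m < N) e m.+1 i.+1).
        set a := T i (E i.+1 N); rewrite ES; move: ((idfun - T i) _) => c.
        rewrite [- (_ - a)]opprB addrA [_ - a - _]addrAC subrK.
        by rewrite opprD addrA [RHS]addrAC.
      rewrite -opprB -sumrB telescope_sumr// opprB /e.
      by rewrite opprB addrA subrK.
    by rewrite -mdist_dnorm; exact: hr.
  rewrite (eq_bigr (fun k => - E k.+1 N - - E k N)) => [|k _].
    by rewrite (telescope_sumr (fun k => - E k N)) // E0 En1 subrr.
  by rewrite opprK addrC.
elim=> [//|k IH] kn.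
apply: (mean_limit_mem _ _ (z^~ k.+1) _ hn0 Dc Dn) => //.
have : forall j, (j <= n.+1)%N -> bounded_seq (E j).
  elim=> [_|j IHj jn]; first by apply: eq_bounded_seq (bounded_seq_cst 0) => N.
  apply: eq_bounded_seq (bounded_seqB (IHj (ltnW jn)) (d_bounded j jn)) => N.
  by rewrite subKr.
exact.
Qed.

(** The harmonic chain from x to y: its increments are the S^-1 S_j (x - y). *)
Definition interpolation x y k :=
  y + Sinv (\sum_(k <= j < n.+1) mixed_comp T n j (x - y)).

Lemma interpolation0 x y : interpolation x y 0 = x.
Proof.
by have := SK (x - y); rewrite /interpolation fct_sumE => ->; rewrite subrKC.
Qed.

Lemma interpolation_end x y : interpolation x y n.+1 = y.
Proof. by rewrite /interpolation big_geq// (Endo0 SinvE.1) addr0. Qed.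

Lemma interpolation_harmonic
    (SinvK : cancel Sinv (\sum_(0 <= j < n.+1) mixed_comp T n j)) x y :
  harmonic (interpolation x y).
Proof.
have TSinv i v : T i (Sinv v) = Sinv (T i v).
  apply: (can_inj SK); rewrite SinvK fct_sumE.
  under eq_bigr => k _ do rewrite mixed_compT//.
  rewrite -(Endo_sum (TE i).1); congr (T i _).
  by have := SinvK v; rewrite fct_sumE.
move=> i lin; rewrite /interpolation.
have /(congr1 Sinv) := mixed_comp_step T TE Tcomm n i (x - y) lin.
rewrite subfE (EndoB SinvE.1) -!TSinv => step.
rewrite (@big_ltn _ _ _ i) ?(@big_ltn _ _ _ i.+1) ?ltnS ?(ltnW lin)//.
rewrite !(EndoD SinvE.1) addrCA.
rewrite [y + (Sinv _ + _)]addrCA [y + (Sinv _ + _)]addrCA.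
move: (y + _) => w; rewrite !(EndoD (TE i).1) step subfE.
by rewrite !addrA subrK addrAC addrK.
Qed.

End Harmonic.

(** * The real counterpart *)

Section Reals.
Context {R : realFieldType}.
Implicit Types (t w : nat -> R).

(** Since w 0 <= 0, a first positive value is reached by an increase, and the
    inequality makes w increase from then on, up to w n.+1 > 0. *)
Lemma discrete_max_principle n t w :
  (forall i, (i < n)%N -> 0 < t i < 1) ->
  (forall i, (i < n)%N -> w i.+1 <= t i * w i + (1 - t i) * w i.+2) ->
  w 0 <= 0 -> w n.+1 <= 0 -> forall k, (k <= n.+1)%N -> w k <= 0.
Proof.
move=> ht hw w0 wn1.
have H m : (m <= n)%N -> w m <= 0 \/ w m <= w m.+1.
  elim: m => [|m IH] mn; first by left.
  have /andP[t0 t1] := ht m mn; have hm := hw m mn.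
  have [wm|wm] := leP (w m.+1) 0; [by left|right].
  have mm1 : w m <= w m.+1 by have [|//] := IH (ltnW mn); lra.
  rewrite leNgt; apply/negP => lt; suff : w m.+1 < w m.+1 by rewrite ltxx.
  by apply: le_lt_trans hm _; nra.
move=> k kn; rewrite -(subKn kn); elim: (n.+1 - k)%N => [|j IH].
  by rewrite subn0.
have [jn|jn] := ltnP n j; first by
  rewrite subSS; move/ltnW: jn; rewrite -subn_eq0 => /eqP->.
have [//|] := H (n.+1 - j.+1)%N (leq_subr _ _).
by rewrite subnSK// => /le_trans; apply.
Qed.

Definition mixed_prod t n k : R :=
  (\prod_(0 <= i < k) t i) * \prod_(k <= i < n) (1 - t i).

Lemma mixed_prod_step t n i : (i < n)%N ->
  t i * mixed_prod t n i = (1 - t i) * mixed_prod t n i.+1.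
Proof.
move=> lin; rewrite /mixed_prod (big_ltn lin) big_nat_recr//=.
by ring.
Qed.

Lemma mixed_prod_gt0 t n k : (k <= n)%N ->
  (forall i, (i < n)%N -> 0 < t i < 1) -> 0 < mixed_prod t n k.
Proof.
move=> kn ht; apply: mulr_gt0; rewrite big_nat.
all: apply: prodr_gt0 => i /andP[_ ik].
  by have /andP[] := ht i (leq_trans ik kn).
by have /andP[_] := ht i ik; rewrite subr_gt0.
Qed.

End Reals.

(** * Families indexed by ordinals as families indexed by numbers *)

Section Extension.
Context {n : nat} {A : Type} (a : A) (F : 'I_n -> A).

Definition extend_ord (i : nat) : A := oapp F a (insub i).

Lemma extend_ordE (i : 'I_n) : extend_ord i = F i.
Proof. by rewrite /extend_ord valK. Qed.

Lemma extend_ordP (P : A -> Prop) : P a -> (forall i, P (F i)) ->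
  forall i, P (extend_ord i).
Proof. by move=> Pa PF i; rewrite /extend_ord; case: insub => [j|] /=. Qed.

Lemma big_extend_ord_lt {B : Type} {idx : B} (op : Monoid.law idx)
    (G : A -> B) k :
  (k <= n)%N -> \big[op/idx]_(i < n | (i < k)%N) G (F i) =
  \big[op/idx]_(0 <= i < k) G (extend_ord i).
Proof.
move=> kn; rewrite (big_nat_widen _ _ _ _ _ kn) big_mkord.
by apply: eq_bigr => i _; rewrite extend_ordE.
Qed.

Lemma big_extend_ord_ge {B : Type} {idx : B} (op : Monoid.law idx)
    (G : A -> B) k :
  \big[op/idx]_(i < n | (k <= i)%N) G (F i) =
  \big[op/idx]_(k <= i < n) G (extend_ord i).
Proof.
rewrite big_geq_mkord.
by apply: eq_bigr => i _; rewrite extend_ordE.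
Qed.

End Extension.

Theorem theorem5p14 (R : realType) (X : metricZmodType R)
    (n0 : nat) (hn0 : (1 < mu X n0)%E)
    (D : set X) (Dclosed : closed D) (Dbounded : metric_bounded D)
    (Dconvex : nconvex n0 D)
    (f : X -> R) (n : nat) (T : 'I_n -> X -> X) (t : 'I_n -> R)
    (hTt : forall i, Rfd D (EFin \o f) (T i, t i))
    (ht : forall i, 0 < t i < 1)
    (Tcomm : forall i j, T i \o T j = T j \o T i)
    (Sinv : X -> X)
    (SK : cancel (\sum_(0 <= j < n.+1) Sk T j) Sinv)
    (SinvK : cancel Sinv (\sum_(0 <= j < n.+1) Sk T j))
    (hSinv : Endod Sinv)
    (k : nat) (hk : (1 <= k <= n)%N) :
  Rfd D (EFin \o f)
    (Sinv \o \sum_(k <= j < n.+1) Sk T j,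
     (\sum_(0 <= j < n.+1) sk t j)^-1 * \sum_(k <= j < n.+1) sk t j).
Proof.
have /andP[_ kn] := hk.
(* The default values extend the hypotheses on T and t to all indices. *)
pose T' := extend_ord idfun T; pose t' := extend_ord (2^-1) t.
have T'E : forall i, Endod (T' i).
  apply: (extend_ordP idfun T Endod) => [|i].
    exact: Endod_idfun.
  by have [] := hTt i.
have T'comm i j x : T' i (T' j x) = T' j (T' i x).
  suff TT l : T' i \o T' l = T' l \o T' i.
    by move: (congr1 (fun g => g x) (TT j)).
  apply: (extend_ordP idfun T (fun U => U \o T' l = T' l \o U)) => [//|{}i].
  exact: (extend_ordP idfun T (fun U => T i \o U = U \o T i)).
have t'01 i : 0 < t' i < 1.
  apply: (extend_ordP (2^-1) t (fun a => 0 < a < 1)) => //; lra.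
have SkE j : (j <= n)%N -> Sk T j = mixed_comp T' n j.
  move=> jn; rewrite /Sk /mixed_comp (big_extend_ord_lt idfun T _ id j jn).
  by rewrite (big_extend_ord_ge idfun T _ (fun U => idfun - U)).
have skE j : (j <= n)%N -> sk t j = mixed_prod t' n j.
  move=> jn; rewrite /sk /mixed_prod (big_extend_ord_lt (2^-1) t _ id j jn).
  by rewrite (big_extend_ord_ge (2^-1) t _ (fun a => 1 - a)).
have sum_SkE m :
    \sum_(m <= j < n.+1) Sk T j = \sum_(m <= j < n.+1) mixed_comp T' n j.
  by apply: eq_big_nat => j /andP[_]; rewrite ltnS; exact: SkE.
have sum_skE m :
    \sum_(m <= j < n.+1) sk t j = \sum_(m <= j < n.+1) mixed_prod t' n j.
  by apply: eq_big_nat => j /andP[_]; rewrite ltnS; exact: skE.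
rewrite !sum_skE !sum_SkE in SK SinvK *.
pose s m := \sum_(m <= j < n.+1) mixed_prod t' n j.
have sk_gt0 j : (j < n.+1)%N -> 0 < mixed_prod t' n j.
  by rewrite ltnS => jn; apply: mixed_prod_gt0 => // i _.
have s_ge0 m : 0 <= s m.
  by rewrite /s big_nat sumr_ge0// => j /andP[_ /sk_gt0/ltW].
have s0 : 0 < s 0.
  by rewrite /s big_ltn// ltr_wpDr ?sk_gt0 //; exact: s_ge0.
have s_le : s k <= s 0.
  rewrite /s (big_cat_nat (leq0n k) (leqW kn)) /= lerDr big_nat sumr_ge0//.
  by move=> j /andP[_ jk]; rewrite ltW// sk_gt0// ltnS (leq_trans (ltnW jk)).
have ME : Endod (Sinv \o \sum_(k <= j < n.+1) mixed_comp T' n j).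
  by apply: Endod_comp => //; apply: Endod_sum => j; exact: mixed_comp_Endod.
have uE x y : (Sinv \o \sum_(k <= j < n.+1) mixed_comp T' n j) x +
    (idfun - (Sinv \o \sum_(k <= j < n.+1) mixed_comp T' n j)) y =
    interpolation T' n Sinv x y k.
  rewrite subfE addrCA -(EndoB ME.1) /= /interpolation.
  by rewrite fct_sumE.
have T'D i : (i < n)%N -> Tconvex (T' i) D.
  move=> lin; rewrite -[i]/(val (Ordinal lin)) /T' extend_ordE.
  by have [[_ _ []]] := hTt (Ordinal lin).
have u_harm x y :=
  interpolation_harmonic T' T'E T'comm n Sinv hSinv SK SinvK x y.
have uD x y : D x -> D y -> forall m, (m <= n.+1)%N ->
    D (interpolation T' n Sinv x y m).
  move=> Dx Dy; apply: (harmonic_mem T' T'E T'comm n Sinv hSinv SK n0) => //.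
    by rewrite interpolation0.
  by rewrite interpolation_end.
split=> //; split=> /=; first exact: ME.1.
  by rewrite mulr_ge0 ?invr_ge0 ?s_ge0//= ler_pdivrMl// mulr1.
split=> [x y Dx Dy|x y Dx Dy]; rewrite uE; first exact: uD (leqW kn).
rewrite -/(s 0) -/(s k) -!EFinM -EFinD lee_fin.
set u := interpolation T' n Sinv x y.
(* v joins f x to f y and turns the convexity inequality along the chain into
   an equality. *)
pose v m := f y + (s 0)^-1 * s m * (f x - f y).
have vS i : (i < n)%N -> v i.+1 = t' i * v i + (1 - t' i) * v i.+2.
  move=> lin; have := mixed_prod_step t' n i lin.
  rewrite /v; move: (s 0)^-1 => K; rewrite /s.
  rewrite (@big_ltn _ _ _ i) ?(@big_ltn _ _ _ i.+1) ?ltnS ?(ltnW lin)//.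
  set a := mixed_prod _ _ i; set b := mixed_prod _ _ i.+1.
  set c := \sum_(_ <= _ < _) _.
  move=> ab.
  transitivity (f y + K * (t' i * a + t' i * b + c) * (f x - f y)); last by ring.
  by rewrite ab; ring.
suff : f (u k) - v k <= 0.
  by rewrite subr_le0 => /le_trans; apply; rewrite /v; lra.
apply: (discrete_max_principle n t' (fun m => f (u m) - v m)) => [i _//|i lin|||].
- have : f (u i.+1) <= t' i * f (u i) + (1 - t' i) * f (u i.+2).
    rewrite {1}/u u_harm// -/u.
    have iD m : (m <= n.+1)%N -> D (u m) by exact: uD.
    have [[_ _ [_ fT]] _] := hTt (Ordinal lin).
    have := fT (u i) (u i.+2) (iD i (leqW (ltnW lin))) (iD i.+2 lin).
    rewrite /= -!EFinM -EFinD lee_fin.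
    by rewrite -(extend_ordE (2^-1) t) -(extend_ordE idfun T).
  by rewrite vS//; lra.
- by rewrite /u interpolation0// /v mulVf ?gt_eqF// mul1r subrKC subrr.
- by rewrite /u interpolation_end// /v [s n.+1]big_geq// mulr0 mul0r addr0 subrr.
- exact: leqW.
Qed.
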